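(* Every Rosenthal compact space is $\omega_1$-sequentially compact.
   Context: For a Polish space $P$, $B_1(P)$ denotes the set of all Baire-class-1 functions $P\to\mathbb{R}$ (pointwise limits of sequences of continuous functions), endowed with the topology of pointwise convergence. A Rosenthal compact space (Rosenthal compactum) is a compact subset $K\subseteq B_1(P)$ for some Polish space $P$. For sets of naturals, $s\sqsubseteq t$ means $s$ is an initial segment of $t$. For $\mathcal{F}\subseteq[\omega]^{<\omega}$ and $M\subseteq\omega$ let $\mathcal{F}|M=\{s\in\mathcal{F}:s\subseteq M\}$. A barrier on an infinite set $M\subseteq\omega$ is a family $\mathcal{B}$ of finite subsets of $M$ such that (a) $s\subseteq t$ implies $s=t$ for $s,t\in\mathcal{B}$, and (b) every infinite $N\subseteq M$ has an initial segment $s\sqsubseteq N$ with $s\in\mathcal{B}$. Every barrier has a rank: $T(\mathcal{B})=\{s\in[\omega]^{<\omega}:\exists t\in\mathcal{B}\,(s\sqsubseteq t)\}$, $\rho_{T(\mathcal{B})}(s)=\sup\{\rho_{T(\mathcal{B})}(t)+1:t\in T(\mathcal{B}),\ s\sqsubseteq t,\ s\neq t\}$ (with $\sup\emptyset=0$), and $\rho(\mathcal{B})=\rho_{T(\mathcal{B})}(\emptyset)<\omega_1$. If $\mathcal{B}$ is a barrier on an infinite set $M$, $f:\mathcal{B}\to X$ converges to $x\in X$ if for every open $U\ni x$ there is $n\in\omega$ with $f[\mathcal{B}|(M\setminus n)]\subseteq U$. For a barrier $\mathcal{B}$ on $\omega$, $X$ is $\mathcal{B}$-sequentially compact if for every $f:\mathcal{B}\to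 X$ there is an infinite $M\subseteq\omega$ such that $f\restriction(\mathcal{B}|M)$ converges to some point of $X$. For $\alpha<\omega_1$, $X$ is $\alpha$-sequentially compact if it is $\mathcal{B}$-sequentially compact for all barriers $\mathcal{B}$ on $\omega$ of rank $\alpha$; $X$ is $\omega_1$-sequentially compact if it is $\alpha$-sequentially compact for every $\alpha<\omega_1$. *)

(* Defs.v *)
From HB Require Import structures.
From mathcomp Require Import all_boot all_order all_algebra finmap.
From mathcomp Require Import all_classical all_reals topology normedtype.

Set Implicit Arguments.
Unset Strict Implicit.
Unset Printing Implicit Defensive.

Import Order.TTheory GRing.Theory Num.Theory.
Import numFieldNormedType.Exports.

Local Open Scope classical_set_scope.
Local Open Scope ring_scope.

Section Rosenthal.
Context {R : realType}.

Definition separable_space (P : topologicalType) :=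
  exists2 D : set P, countable D & dense D.

(* [d x y = 0 <-> x = y], symmetry and the triangle inequality force
   [0 <= d x y]. *)
Definition complete_compatible_metric (P : topologicalType) (d : P -> P -> R) :=
  [/\ forall x y, d x y = 0 <-> x = y,
      forall x y, d x y = d y x,
      forall x y z, d x z <= d x y + d y z,
      forall (x : P) (A : set P),
        nbhs x A <-> exists2 e, 0 < e & [set y | d x y < e] `<=` A &
      forall u : nat -> P,
        (forall e, 0 < e ->
          exists N, forall m n, (N <= m)%N -> (N <= n)%N -> d (u m) (u n) < e) ->
        exists l : P, u @ \oo --> l].

Definition polish (P : topologicalType) :=
  separable_space P /\ exists d, @complete_compatible_metric P d.

Definition baire_class1 (P : topologicalType) : set {ptws P -> R} :=
  [set f | exists g : nat -> P -> R,
    (forall n, continuous (g n)) /\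
    (forall x, (fun n => g n x) @ \oo --> (f x : R))].

Definition rosenthal_compactum (P : topologicalType) (K : set {ptws P -> R}) :=
  [/\ polish P, K `<=` @baire_class1 P & compact K].

End Rosenthal.

(* [sup f] is the supremum of the countable family [f]; no monotonicity is
   required. Modulo [ord_eq], these notations are exactly the ordinals below
   omega_1. *)
Inductive countable_ord : Type :=
  | ord_zero
  | ord_succ of countable_ord
  | ord_sup of nat -> countable_ord.

(* The inner fixpoint is [a' < b], which is [ord_succ a' <= b]. *)
Fixpoint ord_le (a b : countable_ord) {struct a} : Prop :=
  match a with
  | ord_zero => True
  | ord_succ a' =>
      (fix lt_a' (b : countable_ord) : Prop :=
         match b with
         | ord_zero => False
         | ord_succ b' => ord_le a' b'
         | ord_sup g => exists n, lt_a' (g n)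
         end) b
  | ord_sup f => forall n, ord_le (f n) b
  end.

Definition ord_eq (a b : countable_ord) := ord_le a b /\ ord_le b a.

Definition initial_segment (s t : set nat) :=
  s `<=` t /\ forall i j, t i -> s j -> (i < j)%N -> s i.

Definition family_restr (F : set {fset nat}) (M : set nat) : set {fset nat} :=
  [set s | F s /\ [set` s] `<=` M].

Definition barrier (M : set nat) (B : set {fset nat}) :=
  [/\ infinite_set M,
      forall s, B s -> [set` s] `<=` M,
      forall s t, B s -> B t -> (s `<=` t)%fset -> s = t &
      forall N : set nat, infinite_set N -> N `<=` M ->
        exists2 s, B s & initial_segment [set` s] N].

Definition barrier_tree (B : set {fset nat}) : set {fset nat} :=
  [set s | exists2 t, B t & initial_segment [set` s] [set` t]].

Definition proper_extension (T : set {fset nat}) (t s : {fset nat}) :=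
  [/\ T t, initial_segment [set` s] [set` t] & s <> t].

(* The supremum ranges over the finite sets [t] through their enumeration; the
   entries [ord_zero] contribute nothing and make the empty supremum 0. *)
Fixpoint tree_rank_acc (T : set {fset nat}) (s : {fset nat})
    (h : Acc (proper_extension T) s) {struct h} : countable_ord :=
  ord_sup (fun n =>
    if @choice.unpickle {fset nat} n is Some t then
      match pselect (proper_extension T t s) with
      | left st => ord_succ (tree_rank_acc (Acc_inv h st))
      | right _ => ord_zero
      end
    else ord_zero).

(* The value [ord_zero] off the well-founded part is junk; by
   [wf_barrier_tree] it is never reached on the tree of a barrier. *)
Definition tree_rank (T : set {fset nat}) (s : {fset nat}) : countable_ord :=
  match pselect (Acc (proper_extension T) s) with
  | left h => tree_rank_acc h
  | right _ => ord_zero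
  end.

Definition barrier_rank (B : set {fset nat}) : countable_ord :=
  tree_rank (barrier_tree B) fset0.

Lemma wf_barrier_tree (M : set nat) (B : set {fset nat}) :
  barrier M B -> well_founded (proper_extension (barrier_tree B)).
Proof.
move=> [_ BM Banti Bseg] s; apply: contrapT => ns.
have nAcc_ext (t : {fset nat}) : exists t' : {fset nat},
    ~ Acc (proper_extension (barrier_tree B)) t ->
    proper_extension (barrier_tree B) t' t /\
    ~ Acc (proper_extension (barrier_tree B)) t'.
  apply: contrapT => /forallNP nt.
  have /not_implyP[nAt _] := nt t.
  apply: nAt; split=> t' tt'; apply: contrapT => nAt'.
  by apply: (nt t').
have [g gP] := choice nAcc_ext.
pose u n := iter n g s.
have nu n : ~ Acc (proper_extension (barrier_tree B)) (u n).
  by elim: n => //= n /gP[].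
have uS n : proper_extension (barrier_tree B) (u n.+1) (u n).
  by have [] := gP _ (nu n).
have subuS n : [set` u n] `<=` [set` u n.+1] by have [_ []] := uS n.
have subu m n : (m <= n)%N -> [set` u m] `<=` [set` u n].
  elim: n => [|n IHn]; first by rewrite leqn0 => /eqP->.
  rewrite leq_eqVlt => /predU1P[->//|/IHn mn].
  exact: subset_trans (subuS n).
have nsub n : ~ [set` u n.+1] `<=` [set` u n].
  move=> h; have [_ _] := uS n; apply; apply/fsetP => i.
  by apply/idP/idP; [exact: subuS|exact: h].
pose N := \bigcup_n [set` u n].
have cover (X : {fset nat}) : [set` X] `<=` N -> exists k, [set` X] `<=` [set` u k].
  move=> XN; have Xu i : exists n, i \in X -> i \in u n.
    have [/XN[n _ /= iu]|] := boolP (i \in X); first by exists n.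
    by exists 0%N.
  have [f fP] := choice Xu.
  exists (\max_(i <- X) f i)%N => i /= iX.
  by apply: (subu (f i)); [exact: leq_bigmax_seq|exact: fP].
have uM n : exists2 t, B t & [set` u n.+1] `<=` [set` t].
  by have [[t Bt [ut _]] _ _] := uS n; exists t.
have Ninf : infinite_set N.
  move=> /finite_fsetP[X NX]; have [|k Xk] := cover X; first by rewrite -NX.
  by apply: (nsub k); apply: subset_trans Xk; rewrite -NX => i ui; exists k.+1.
have NM : N `<=` M.
  move=> i [n _ /subuS ui]; have [t Bt ut] := uM n.
  by apply: (BM t) => //; exact: ut.
have [t Bt [tN _]] := Bseg N Ninf NM.
have [k tk] := cover _ tN; have [t' Bt' ut'] := uM k.
have tt' : t = t'.
  apply: Banti => //; apply/fsubsetP => i it.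
  by apply: ut'; apply: subuS; exact: tk.
by apply: (nsub k); apply: subset_trans tk; rewrite tt'.
Qed.

Lemma tree_rankE (T : set {fset nat}) (s : {fset nat}) :
  well_founded (proper_extension T) ->
  tree_rank T s = ord_sup (fun n =>
    if @choice.unpickle {fset nat} n is Some t then
      if `[< proper_extension T t s >] then ord_succ (tree_rank T t)
      else ord_zero
    else ord_zero).
Proof.
move=> wfT; rewrite {1}/tree_rank; case: pselect => [h|/(_ (wfT s))//].
case: h => h /=; congr ord_sup; apply/funext => n.
case: choice.unpickle => // t; case: pselect => [ts|nts].
  rewrite asboolT// /tree_rank; case: pselect => [h'|/(_ (wfT t))//].
  by congr (ord_succ (tree_rank_acc _)); exact: Prop_irrelevance.
by rewrite asboolF.
Qed.

(* Functions on a family of finite sets are total functions of which only the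
   values on the family matter. *)
Definition barrier_converges (X : topologicalType) (M : set nat)
    (B : set {fset nat}) (f : {fset nat} -> X) (x : X) :=
  forall U : set X, open U -> U x ->
    exists n : nat, f @` family_restr B (M `\` `I_n) `<=` U.

Definition barrier_sequentially_compact (B : set {fset nat})
    (X : topologicalType) :=
  forall f : {fset nat} -> X, exists M : set nat,
    infinite_set M /\ exists x : X, barrier_converges M (family_restr B M) f x.

Definition ord_sequentially_compact (a : countable_ord) (X : topologicalType) :=
  forall B : set {fset nat}, barrier [set: nat] B ->
    ord_eq (barrier_rank B) a -> barrier_sequentially_compact B X.

Definition omega1_sequentially_compact (X : topologicalType) :=
  forall a : countable_ord, ord_sequentially_compact a X.

(* Main.v *)
(* Let U be a nonprincipal ultrafilter on the naturals. Iterating U along the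
   tree of the barrier B gives an ultrafilter W on the finite sets, and any
   sequence of sets A n in W can be diagonalised: some infinite M has all the
   members of B that lie in a tail of M inside A n, the tail depending on n. So
   it suffices to find countably many A n in W such that, at every point p, the
   values f s p for s in A n have arbitrarily small oscillation as n varies
   (bisequentiality of separable Rosenthal compacta, due to Pol).
   To get them, replace the Polish space by one over it on which every f s is
   continuous. If no such A n exist, there is a nonempty closed set in
   no relatively open part of which a single A in W controls the oscillation,
   whereas the W-limit, being of Baire class 1, has a relatively open set on
   which it is almost constant. A Cantor scheme then produces a copy of the
   Cantor space and a sequence f (i k) that is near that constant where
   the k-th bit is 0 and far from it where it is 1. An ultrafilter limit of the
   sequence has no point of small oscillation on the Cantor space, hence is not
   of Baire class 1. *)
Require Import Defs.
From HB Require Import structures.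
From mathcomp Require Import all_boot all_order all_algebra finmap.
From mathcomp Require Import all_classical all_reals topology normedtype.
From mathcomp Require Import lra.

Set Implicit Arguments.
Unset Strict Implicit.
Unset Printing Implicit Defensive.

Import Order.TTheory GRing.Theory Num.Theory.
Import numFieldNormedType.Exports.

Local Open Scope classical_set_scope.
Local Open Scope ring_scope.

(** * Iterated ultrafilters along a barrier *)

(** For a proper filter this means being an ultrafilter. *)
Definition decisive (T : Type) (F : set_system T) :=
  forall A, F A \/ F (~` A).

Lemma ultra_decisive (T : Type) (F : set_system T) :
  UltraFilter F -> decisive F.
Proof. by move=> FU A; exact: in_ultra_setVsetC. Qed.

Lemma increasing_inj (e : nat -> nat) :
  {homo e : i j / (i < j)%N} -> injective e.
Proof.
by move=> eS i j eij; have [/eS|/eS|//] := ltngtP i j; rewrite eij ltnn.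
Qed.

Lemma infinite_range (T : Type) (e : nat -> T) :
  injective e -> infinite_set (range e).
Proof.
move=> einj /(finite_preimage (fun _ _ _ _ h => einj _ _ h)) fin.
by apply: infinite_nat; apply: sub_finite_set _ fin => i _; exists i.
Qed.

Lemma initial_segment_image (e : nat -> nat) (s : {fset nat}) :
  {homo e : i j / (i < j)%N} -> initial_segment [set` s] (range e) ->
  exists k, [set` s] = e @` `I_k.
Proof.
move=> eS [se sinit].
have [k ks] : exists k, e k \notin s.
  apply: contrapT => /forallNP es.
  apply: (infinite_range (increasing_inj eS)).
  apply: sub_finite_set _ (finite_fset s) => _ [i _ <-] /=.
  by have /negP := es i; rewrite negbK.
have exk : exists k, e k \notin s by exists k.
case: (ex_minnP exk) => {ks exk}k ks kmin.
exists k; apply/seteqP; split => [i /= is_|_ [i /= ik <-]].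
  have [j _ eji] := se _ is_; exists j => //=; rewrite ltnNge; apply/negP => kj.
  move: ks => /negP; apply; move: kj; rewrite leq_eqVlt => /predU1P[->|kj].
    by rewrite eji.
  by apply: (sinit (e k) i) => //; rewrite -eji; exact: eS.
by apply: contraLR (ik) => h; rewrite -leqNgt; exact: kmin.
Qed.

(* [A] belongs to the iterated product of [U] along the tree of [B] above [s]:
   branching [U]-often at each node outside [B] leads into [A]. *)
Inductive tree_large (U : set_system nat) (B A : set {fset nat})
    (s : {fset nat}) : Prop :=
  | tree_leaf of B s & A s
  | tree_node (V : set nat) of ~ B s & U V &
      (forall n, V n -> tree_large U B A (n |` s)%fset).

Section TreeLarge.
Context {U : set_system nat} {UF : ProperFilter U}.
Implicit Types (A B : set {fset nat}) (s : {fset nat}).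

Lemma tree_largeS B A A' s :
  A `<=` A' -> tree_large U B A s -> tree_large U B A' s.
Proof.
move=> AA'; elim=> {}s; first by move=> Bs /AA'; exact: tree_leaf.
by move=> V nBs UV _ IH; exact: (tree_node nBs UV).
Qed.

Lemma tree_largeI B A A' s :
  tree_large U B A s -> tree_large U B A' s -> tree_large U B (A `&` A') s.
Proof.
elim=> {}s.
  by move=> Bs As [_ A's|//]; apply: tree_leaf.
move=> V nBs UV _ IH [//|V' _ UV' lV'].
apply: (tree_node nBs (filterI UV UV')) => n [Vn V'n].
by apply: IH => //; exact: lV'.
Qed.

Lemma tree_large_set0 B s : ~ tree_large U B set0 s.
Proof.
elim=> {}s // V _ UV _ IH; have [n /IH] := filter_ex UV; exact.
Qed.

Lemma tree_large_leaf B A s : B s -> tree_large U B A s -> A s.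
Proof. by move=> Bs []. Qed.

Context (Uoo : \oo `<=` U).

(** An undecided node has undecided children with arbitrarily large labels, since [U] is decisive
    and contains all tails. An undecided root thus starts an infinite increasing thread of undecided
    nodes; the barrier cuts it at a member of [B], and members of [B] are decided. *)
Lemma tree_large_decisive B A : decisive U -> barrier [set: nat] B ->
  tree_large U B A fset0 \/ tree_large U B (~` A) fset0.
Proof.
move=> Udec [_ _ _ Bseg]; apply: contrapT => und0.
pose und s := ~ (tree_large U B A s \/ tree_large U B (~` A) s).
have Ugt m : U [set n | (m <= n)%N] by apply: Uoo; exists m.
have undB s : und s -> ~ B s.
  move=> us Bs; apply: us.
  by have [As|As] := pselect (A s); [left|right]; exact: tree_leaf.
have step s m : exists n, und s -> (m <= n)%N /\ und (n |` s)%fset.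
  apply: contrapT => /forallNP h.
  have us : und s by have /not_implyP[] := h 0%N.
  have dec n : (m <= n)%N ->
      tree_large U B A (n |` s)%fset \/ tree_large U B (~` A) (n |` s)%fset.
    move=> mn; apply: contrapT => nd; apply: (h n) => _; split=> //.
  have nBs := undB s us; apply: us.
  pose V := [set n | tree_large U B A (n |` s)%fset].
  have [UV|UnV] := Udec V; first by left; exact: (tree_node nBs UV).
  right; apply: (tree_node nBs (filterI (Ugt m) UnV)) => n [mn nV].
  by have [//|] := dec n mn.
have [h hP] : exists h : {fset nat} -> nat -> nat, forall s m,
    und s -> (m <= h s m)%N /\ und (h s m |` s)%fset.
  by have [h hP] := choice (fun p => step p.1 p.2); exists (fun s m => h (s, m)) => s m; exact: (hP (s, m)).
pose st := fix st k := if k is k'.+1 then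
  let p := st k' in ((h p.1 p.2) |` p.1, (h p.1 p.2).+1)%fset else (fset0, 0%N).
pose e k := h (st k).1 (st k).2.
have und_st k : und (st k).1.
  by elim: k => [|k /(hP _ (st k).2)[]].
have eS : {homo e : i j / (i < j)%N}.
  apply: homo_ltn => [|k]; first exact: ltn_trans.
  by have [+ _] := hP _ (st k.+1).2 (und_st k.+1).
have stE k : [set` (st k).1] = e @` `I_k.
  elim: k => [|k IH]; first by rewrite II0 image_set0; apply/seteqP; split.
  rewrite IIS image_setU -IH image_set1; apply/seteqP.
  split=> i /=; rewrite in_fset1U; first by case/orP=> [/eqP->|]; [right|left].
  by case=> [->|->]; rewrite ?eqxx ?orbT.
have [s Bs sN] : exists2 s, B s & initial_segment [set` s] (range e).
  by apply: Bseg => //; exact/infinite_range/increasing_inj.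
have [k sk] := initial_segment_image eS sN.
apply: (undB _ (und_st k)).
suff -> : (st k).1 = s by [].
by apply/fsetP => i; have := sk; rewrite -stE => /seteqP[h1 h2]; apply/idP/idP => [/h2|/h1].
Qed.

(** The values of [e] are chosen one by one, each in the intersection of finitely many sets of [U],
    along which the sets of smaller numbers branch. A member of [B] inside a tail of [e] is then
    built up from the empty set through nodes large for [A k]. *)
Lemma tree_large_diagonal B (A : nat -> set {fset nat}) :
  barrier [set: nat] B -> (forall k, tree_large U B (A k) fset0) ->
  exists2 e : nat -> nat, {homo e : i j / (i < j)%N} &
    forall k s, B s -> [set` s] `<=` e @` [set i | (k <= i)%N] -> A k s.
Proof.
move=> [_ _ Banti _] lA.
have Vex k t : exists V, U V /\ (tree_large U B (A k) t -> ~ B t ->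
    forall n, V n -> tree_large U B (A k) (n |` t)%fset).
  have [[Bt At|V nBt UV lV]|nl] := pselect (tree_large U B (A k) t).
  - by exists setT; split=> //; exact: filterT.
  - by exists V.
  - by exists setT; split=> //; exact: filterT.
have [V VP] : exists V : nat -> {fset nat} -> set nat, forall k t,
    U (V k t) /\ (tree_large U B (A k) t -> ~ B t ->
    forall n, V k t n -> tree_large U B (A k) (n |` t)%fset).
  by have [V VP] := choice (fun p => Vex p.1 p.2); exists (fun k t => V (k, t)) => k t; exact: (VP (k, t)).
have nextex m : exists n, (m <= n)%N /\ forall j (t : {fset nat}),
    (j <= m)%N -> (forall i, i \in t -> (i < m)%N) -> V j t n.
  pose I := [fset i in iota 0 m.+1]%fset.
  have IE i : (i \in I) = (i <= m)%N by rewrite in_fset mem_iota.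
  have UI : U (\bigcap_(j in [set` I]) \bigcap_(t in [set` fpowerset I]) V j t).
    apply: filter_bigI => j _; apply: filter_bigI => t _.
    by have [] := VP j t.
  have Um : U [set n | (m <= n)%N] by apply: Uoo; exists m.
  have [n [mn nV]] := filter_ex (filterI Um UI).
  exists n; split=> // j t jm tm; apply: nV => /=; first by rewrite IE.
  by rewrite fpowersetE; apply/fsubsetP => i /tm im; rewrite IE ltnW.
have [next nextP] := choice nextex.
pose b := fix b k := if k is k'.+1 then (next (b k')).+1 else 0%N.
pose e k := next (b k).
have eS : {homo e : i j / (i < j)%N}.
  apply: homo_ltn => [|k]; first exact: ltn_trans.
  by have [+ _] := nextP (b k.+1).
have leb k : (k <= b k)%N.
  elim: k => // k IH; apply: leq_ltn_trans IH _ => /=.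
  by rewrite ltnS; have [] := nextP (b k).
have eb i k : (i < k)%N -> (e i < b k)%N.
  case: k => // k; rewrite ltnS => ik; rewrite /b -/b ltnS.
  by move: ik; rewrite leq_eqVlt => /predU1P[->//|/eS/ltnW].
exists e => // k s Bs se.
pose L j := [seq e l | l <- iota 0 j].
have LS j : L j.+1 = rcons (L j) (e j).
  by rewrite /L -[in LHS]addn1 iotaD map_cat cats1.
pose t j := [fset i in s | i \in L j]%fset.
have tE j i : (i \in t j) = (i \in s) && (i \in L j) by rewrite !inE.
have ts j : (t j `<=` s)%fset by apply/fsubsetP => i; rewrite tE => /andP[].
have tb j i : i \in t j -> (i < b j)%N.
  rewrite tE => /andP[_ /mapP[l]]; rewrite mem_iota => /andP[_ lj] ->.
  exact: eb.
have tS j : t j.+1 = if e j \in s then (e j |` t j)%fset else t j.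
  apply/fsetP => i; rewrite tE LS mem_rcons in_cons.
  have [->|ij] := eqVneq i (e j).
    by case: ifPn => [ejs|/negPf ejs]; rewrite ?in_fset1U ?tE ?eqxx ?ejs.
  by case: ifP; rewrite ?in_fset1U ?(negPf ij) tE.
have tlarge j : tree_large U B (A k) (t j).
  elim: j => [|j IH].
    suff -> : t 0%N = fset0 by [].
    by apply/fsetP => i; rewrite tE andbF.
  rewrite tS; case: ifPn => // ejs.
  (* If [t j] is already in [B], the antichain condition gives [t j = s], and adding [e j] changes
     nothing. *)
  have [Bt|nBt] := pselect (B (t j)).
    by rewrite (Banti _ _ Bt Bs (ts j)) mem_fset1U// -(Banti _ _ Bt Bs (ts j)).
  have [_ Vj] := VP k (t j); apply: Vj => //.
  have [_] := nextP (b j); apply; last exact: tb.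
  (* Here [k <= i <= b i], so [V k] was among the sets respected when [e i] was chosen. *)
  have [i ki /= eij] := se _ ejs.
  by rewrite -(increasing_inj eS eij); exact: leq_trans ki (leb i).
suff : tree_large U B (A k) s by exact: tree_large_leaf.
(* Since [l <= e l], every element of [s] occurs at an index not above the maximum of [s]. *)
suff <- : t (\max_(i <- s) i).+1 = s by exact: tlarge.
apply/eqP; rewrite eqEfsubset ts; apply/fsubsetP => i si.
rewrite tE si /=; have [l _ eli] := se _ si.
rewrite -eli; apply: map_f; rewrite mem_iota /= add0n ltnS.
have le_e : (l <= e l)%N.
  by elim: (l) => // k' IH; apply: leq_ltn_trans IH (eS _ _ _).
by rewrite (leq_trans le_e)// eli; exact: leq_bigmax_seq.
Qed.
End TreeLarge.

(** * Complete spaces and Baire category *)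

(* A sequence of reflexive symmetric relations halving one another stands for
   the [2^-n]-balls of a complete metric; unlike a metric, it passes to
   products with [nat -> nat] and to subsets without any real arithmetic. *)
Record complete_scale (T : Type) (E : nat -> T -> T -> Prop) : Prop :=
  CompleteScale {
    scale_refl : forall n x, E n x x;
    scale_sym : forall n x y, E n x y -> E n y x;
    scale_trans : forall n x y z, E n.+1 x y -> E n.+1 y z -> E n x z;
    scale_lim : forall u : nat -> T,
      (forall m n, (m <= n)%N -> E m (u m) (u n)) ->
      exists l, forall n, E n (u n) l }.

Definition scale_closed (T : Type) (E : nat -> T -> T -> Prop) (F : set T) :=
  forall x, (forall n, exists2 y, E n x y & F y) -> F x.

Definition scale_continuous (R : realType) (T : Type)
    (E : nat -> T -> T -> Prop) (g : T -> R) :=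
  forall x e, 0 < e -> exists n, forall y, E n x y -> `|g x - g y| < e.

Definition scale_baire1 (R : realType) (T : Type)
    (E : nat -> T -> T -> Prop) (y : T -> R) :=
  exists2 g : nat -> T -> R, forall n, scale_continuous E (g n) &
    forall x e, 0 < e -> exists N, forall n, (N <= n)%N -> `|g n x - y x| < e.

Section CompleteScale.
Context {T : Type} {E : nat -> T -> T -> Prop} (cE : complete_scale E).

Lemma scale_leq m n x y : (m <= n)%N -> E n x y -> E m x y.
Proof.
move=> /subnK <-; elim: (n - m)%N => // k IH h; apply: IH.
exact: (scale_trans cE h (scale_refl cE _ _)).
Qed.

(** The jump at stage [k] uses one half of the [r k]-ball. All later jumps fit in the other half
    because [r] grows by at least two, the extra unit leaving room for the limit. *)
Lemma scale_nested (u : nat -> T) (r : nat -> nat) :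
  (forall k, E (r k).+1 (u k) (u k.+1)) -> (forall k, (r k).+1 < r k.+1)%N ->
  exists l, forall k, E (r k) (u k) l.
Proof.
move=> uE rS.
have step k x : E (r k).+1 (u k.+1) x -> E (r k) (u k) x.
  exact: (scale_trans cE (uE k)).
have rk k : (k <= r k)%N.
  by elim: k => // k IH; rewrite (leq_ltn_trans IH)// (ltn_trans _ (rS k)).
have uu d k : E (r k) (u k) (u (d + k)%N).
  elim: d k => [|d IH] k; first exact: scale_refl.
  apply: step; rewrite addSnnS; apply: scale_leq (IH k.+1).
  exact: ltnW (rS k).
have [l ul] : exists l, forall k, E k (u k) l.
  apply: (scale_lim cE) => m n mn; rewrite -(subnK mn).
  exact: scale_leq (rk m) (uu _ _).
exists l => k; apply: step; set j := (r k.+1 + k.+1)%N.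
apply: (@scale_trans _ _ cE _ _ (u j)).
  exact: scale_leq (rS k) (uu _ _).
by apply: scale_leq (ul j); rewrite (leq_trans (rS k))// leq_addr.
Qed.

(** If no [C N] contained a relatively open piece of [F], a sequence in [F] could leave the [C N]
    one after another, each time with a ball that misses [C N]; its limit would lie in [F] but in
    none of them. *)
Lemma scale_baire_category (F : set T) (C : nat -> set T) :
  scale_closed E F -> F !=set0 -> (forall N, scale_closed E (C N)) ->
  F `<=` \bigcup_N C N ->
  exists N x n, F x /\ forall y, F y -> E n x y -> C N y.
Proof.
move=> Fcl [x0 Fx0] Ccl FC; apply: contrapT => nope.
have step N (p : T * nat) : exists q : T * nat, F p.1 ->
    [/\ F q.1, E p.2.+1 p.1 q.1, (p.2.+1 < q.2)%N &
        forall z, E q.2 q.1 z -> ~ C N z].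
  apply: contrapT => /forallNP h.
  have /not_implyP[Fp _] := h p.
  apply: nope; exists N, p.1, p.2.+1; split=> // y Fy py.
  apply: Ccl => n; apply: contrapT => /forall2NP Cn.
  apply: (h (y, maxn n p.2.+2)) => _; split=> //=.
    by rewrite leq_maxr.
  move=> z yz Cz; have [] := Cn z => //; apply.
  exact: scale_leq (leq_maxl _ _) yz.
have [h hP] := choice (fun Np => step Np.1 Np.2).
pose st := fix st k := if k is k'.+1 then h (k', st k') else (x0, 0%N).
have Fst k : F (st k).1.
  by elim: k => // k IH; have [] := hP (k, st k) IH.
have hst k := hP (k, st k) (Fst k).
have [l ul] : exists l, forall k, E (st k).2 (st k).1 l.
  by apply: scale_nested => k; have [] := hst k.
have stk k : (k <= (st k).2)%N.
  elim: k => // k IH; have [_ _ + _] := hst k.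
  by move=> /ltnW; apply: leq_trans.
have Fl : F l.
  apply: Fcl => n; exists (st n).1 => //; apply: (scale_sym cE).
  exact: scale_leq (stk n) (ul n).
have [N _ CNl] := FC _ Fl.
by have [_ _ _ /(_ l (ul N.+1))] := hst N.
Qed.

Context {R : realType}.

(** Baire category is applied to the closed sets where the approximations from [N] on differ by at
    most [e / 4]: on a relatively open piece of [F], [y] is within [e / 4] of the continuous
    [g N]. *)
Lemma scale_baire1_oscillation (y : T -> R) (F : set T) (e : R) :
  scale_baire1 E y -> scale_closed E F -> F !=set0 -> 0 < e ->
  exists2 x, F x & exists n, forall z w, F z -> F w -> E n x z -> E n x w ->
    `|y z - y w| <= e.
Proof.
move=> [g gc gy] Fcl F0 e0.
pose C N := [set p | forall m n, (N <= m)%N -> (N <= n)%N ->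
  `|g m p - g n p| <= e / 4].
have [] := @scale_baire_category F C Fcl F0.
- move=> N x xC m n Nm Nn; apply/ler_addgt0Pr => d d0.
  have d2 : 0 < d / 2 by lra.
  have [k1 k1P] := gc m x _ d2; have [k2 k2P] := gc n x _ d2.
  have [z xz Cz] := xC (maxn k1 k2).
  have h1 := k1P _ (scale_leq (leq_maxl _ _) xz).
  have h2 := k2P _ (scale_leq (leq_maxr _ _) xz).
  have h3 := Cz m n Nm Nn.
  have h4 := ler_distD (g m z) (g m x) (g n x).
  have h5 := ler_distD (g n z) (g m z) (g n x).
  rewrite (distrC (g n z)) in h5; lra.
- move=> x _; have e8 : 0 < e / 8 by lra.
  have [N NP] := gy x _ e8; exists N => // m n Nm Nn.
  have h1 := NP m Nm; have h2 := NP n Nn.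
  have := ler_distD (y x) (g m x) (g n x).
  rewrite (distrC (y x)); lra.
move=> N [x [n [Fx xC]]]; exists x => //.
have e4 : 0 < e / 4 by lra.
have near z : F z -> E n x z -> `|g N z - y z| <= e / 4.
  move=> Fz xz; apply/ler_addgt0Pr => d d0.
  have [M MP] := gy z _ d0.
  have h1 := MP (maxn M N) (leq_maxl _ _).
  have h2 := xC _ Fz xz N (maxn M N) (leqnn _) (leq_maxr _ _).
  have := ler_distD (g (maxn M N) z) (g N z) (y z); lra.
have [k kP] := gc N x _ e4.
exists (maxn n k) => z w Fz Fw xz xw.
have yz := near _ Fz (scale_leq (leq_maxl _ _) xz).
have yw := near _ Fw (scale_leq (leq_maxl _ _) xw).
have gz := kP _ (scale_leq (leq_maxr _ _) xz).
have gw := kP _ (scale_leq (leq_maxr _ _) xw).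
have h1 := ler_distD (g N z) (y z) (y w).
have h2 := ler_distD (g N x) (g N z) (y w).
have h3 := ler_distD (g N w) (g N x) (y w).
rewrite distrC in yz; rewrite distrC in gz; lra.
Qed.

End CompleteScale.

(** * Bisequentiality *)

Lemma filter_size (I : Type) (W : set_system I) (Q : seq bool -> set I) m :
  Filter W -> (forall t, size t = m -> W (Q t)) ->
  W [set i | forall t, size t = m -> Q t i].
Proof.
move=> WF; elim: m Q => [|m IH] Q WQ.
  apply: filterS (WQ [::] erefl) => i Qi t /eqP.
  by rewrite size_eq0 => /eqP->.
have WQ2 t : size t = m -> W (Q (true :: t) `&` Q (false :: t)).
  by move=> tm; apply: filterI; apply: WQ; rewrite /= tm.
apply: filterS (IH _ WQ2) => i Qi [//|[] t] [tm]; by have [] := Qi t tm.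
Qed.

Lemma cantor_complete_scale :
  complete_scale (fun n (z w : nat -> bool) => forall j, (j < n)%N -> z j = w j).
Proof.
split=> [//|n z w zw j jn|n x y z xy yz j jn|u uE].
- by rewrite zw.
- by rewrite xy ?yz// ltnW.
- by exists (fun j => u j.+1 j) => n j jn; rewrite (uE j.+1 n).
Qed.

Section Bisequential.
Context {R : realType} {T : Type} {E : nat -> T -> T -> Prop}.
Context (cE : complete_scale E) {I : Type} (f : I -> T -> R).

(** The form in which compactness of [K] is carried over to the abstract space: the family [f] has
    all its ultrafilter limits, and they are of Baire class 1. *)
Definition baire1_limits := forall G : set_system I,
  ProperFilter G -> decisive G -> exists2 y, scale_baire1 E y &
    forall p e, 0 < e -> G [set i | `|f i p - y p| < e].

Lemma no_cantor_scheme (c : seq bool -> T) (r : nat -> nat) (i : nat -> I)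
    (c0 d : R) :
  baire1_limits -> 0 < d ->
  (forall b t, E (r (size t)).+1 (c t) (c (b :: t))) ->
  (forall k, (r k).+1 < r k.+1)%N ->
  (forall t z, E (r (size t).+1) (c (true :: t)) z ->
    4 * d <= `|f (i (size t)) z - c0|) ->
  (forall t z, E (r (size t).+1) (c (false :: t)) z ->
    `|f (i (size t)) z - c0| <= 2 * d) ->
  False.
Proof.
move=> Hlim d0 cS rS ctrue cfalse.
have [U [UU Uoo]] := ultraFilterLemma eventually_filter.
(* The newest bit comes first, so that [b :: t] is a child of the node [t]. *)
pose pre (z : nat -> bool) := fix pre m :=
  if m is m'.+1 then z m' :: pre m' else [::].
have size_pre z m : size (pre z m) = m by elim: m => //= m ->.
have pre_eq z w m : (forall j, (j < m)%N -> z j = w j) -> pre z m = pre w m.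
  elim: m => //= m IH zw; rewrite zw// IH// => j jm.
  by rewrite zw// ltnW.
have rk k : (k <= r k)%N.
  by elim: k => // k IH; rewrite (leq_ltn_trans IH)// (ltn_trans _ (rS k)).
have phi_ex (z : nat -> bool) : exists l, forall k, E (r k) (c (pre z k)) l.
  apply: (scale_nested cE) => // k.
  by have := cS (z k) (pre z k); rewrite size_pre.
have [phi phiP] := choice phi_ex.
have phi1 z k : z k = true -> 4 * d <= `|f (i k) (phi z) - c0|.
  move=> zk; have := phiP z k.+1; rewrite /= zk => h.
  by have := ctrue (pre z k) (phi z); rewrite size_pre; apply.
have phi0 z k : z k = false -> `|f (i k) (phi z) - c0| <= 2 * d.
  move=> zk; have := phiP z k.+1; rewrite /= zk => h.
  by have := cfalse (pre z k) (phi z); rewrite size_pre; apply.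
have Gdec : decisive (i @ U).
  by move=> A; apply: (ultra_decisive UU).
have [y [g gc gy] yP] := Hlim (i @ U) _ Gdec.
have yphi : scale_baire1
    (fun n (z w : nat -> bool) => forall j, (j < n)%N -> z j = w j) (y \o phi).
  exists (fun n => g n \o phi) => [n z e e0|z e e0]; last exact: gy.
  have [k kP] := gc n (phi z) e e0.
  exists k.+1 => w zw; apply: kP.
  apply: (@scale_trans _ _ cE _ _ (c (pre z k.+1))).
    apply: (scale_sym cE); exact: (scale_leq cE (rk k.+1)).
  rewrite (pre_eq _ _ _ zw); exact: (scale_leq cE (rk k.+1)).
have [||z0 _ [n nP]] := scale_baire1_oscillation cantor_complete_scale yphi
  _ _ d0 (F := setT).
- by [].
- by exists (fun=> true).
(* Two branches in the cylinder of [z0], constantly [b] from [n] on. On one of them [y] is at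
   distance at least [4 * d - d / 4] from [c0], on the other at most [2 * d + d / 4], against an
   oscillation of at most [d]. *)
pose z b j := if (j < n)%N then z0 j else b.
have zE b j : (j < n)%N -> z0 j = z b j by rewrite /z => ->.
have := nP (z true) (z false) Logic.I Logic.I (zE true) (zE false).
have d4 : 0 < d / 4 by lra.
have Un : U [set k | (n <= k)%N] by apply: Uoo; exists n.
have Ut : U (i @^-1` _) := yP (phi (z true)) _ d4.
have Uf : U (i @^-1` _) := yP (phi (z false)) _ d4.
have [k [[yt yf] nk]] := filter_ex (filterI (filterI Ut Uf) Un).
have zk b : z b k = b by rewrite /z ltnNge nk.
move: yt yf => /= yt yf.
have h1 := phi1 _ _ (zk true); have h0 := phi0 _ _ (zk false).
have h2 := ler_distD (y (phi (z true))) (f (i k) (phi (z true))) c0.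
have h3 := ler_distD (y (phi (z false))) (y (phi (z true))) c0.
have h4 := ler_distD (f (i k) (phi (z false))) (y (phi (z false))) c0.
rewrite distrC in yf; lra.
Qed.

(** For a proper filter [W] and fixed [e], these sets form a sigma-ideal. *)
Definition uniformly_coverable (W : set_system I) (e : R) (Q : set T) :=
  exists A : nat -> set I, (forall k, W (A k)) /\ forall p, Q p ->
    exists k, forall i j, A k i -> A k j -> `|f i p - f j p| <= e.

Section Coverable.
Context (W : set_system I) (WF : ProperFilter W) (e : R).

Lemma uniformly_coverableS Q Q' :
  Q `<=` Q' -> uniformly_coverable W e Q' -> uniformly_coverable W e Q.
Proof. by move=> QQ' [A [WA AP]]; exists A; split=> // p /QQ'; exact: AP. Qed.

Lemma uniformly_coverable_bigcup (J : countType) (D : set J) (Q : J -> set T) :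
  (forall k, D k -> uniformly_coverable W e (Q k)) ->
  uniformly_coverable W e (\bigcup_(k in D) Q k).
Proof.
move=> QW.
have exA k : exists A : nat -> set I, (forall m, W (A m)) /\ (D k -> forall p,
    Q k p -> exists m, forall i j, A m i -> A m j -> `|f i p - f j p| <= e).
  have [Dk|nDk] := pselect (D k); first by have [A [? ?]] := QW k Dk; exists A.
  by exists (fun=> setT); split=> // m; exact: filterT.
have [A AP] := choice exA.
exists (fun n => if @choice.unpickle (J * nat)%type n is Some (k, m) then A k m
  else setT); split=> [n|p [k Dk Qkp]].
  by case: choice.unpickle => [[k m]|]; [have [] := AP k|exact: filterT].
have [_ /(_ Dk p Qkp) [m mP]] := AP k.
by exists (choice.pickle (k, m)); rewrite choice.pickleK.
Qed.

Lemma uniformly_coverableU Q Q' :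
  uniformly_coverable W e Q -> uniformly_coverable W e Q' ->
  uniformly_coverable W e (Q `|` Q').
Proof.
move=> cQ cQ'; rewrite -bigcup2E; apply: uniformly_coverable_bigcup.
by move=> [|[|k]] _ //=; exact: uniformly_coverableS cQ.
Qed.

End Coverable.

(* Off the open coverable sets, no nonempty relatively open set lies in a
   single [{p | the f i p, i in A, differ by at most e}], while the [W]-limit has
   a point of small oscillation; this splits points into two kinds and yields
   a Cantor scheme. *)
Lemma uniformly_coverableT (J : countType) (b : J -> set T)
    (W : set_system I) (e : R) :
  (forall x n, exists2 k, b k x & forall y, b k y -> E n x y) ->
  (forall i, scale_continuous E (f i)) -> baire1_limits ->
  ProperFilter W -> decisive W -> 0 < e -> uniformly_coverable W e setT.
Proof.
move=> bE fc Hlim WF Wdec e0; apply: contrapT => ncT.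
pose cov := uniformly_coverable W e.
(* The points without a coverable ball. By the countable base the other points form a coverable set,
   so no ball relative to [P'] is coverable either. *)
pose P' := [set x | forall n, ~ cov (E n x)].
have P'cl : scale_closed E P'.
  move=> x xP' n covx; have [y xy /(_ n.+1)] := xP' n.+1; apply.
  by apply: uniformly_coverableS covx => z; exact: (scale_trans cE).
have covC : cov (~` P').
  have : cov (\bigcup_(k in [set k | cov (b k)]) b k).
    exact: uniformly_coverable_bigcup.
  apply: uniformly_coverableS => x /existsNP[n /contrapT covx].
  have [k kx kn] := bE x n; exists k => //.
  exact: uniformly_coverableS covx.
have P'ball x n : P' x -> ~ cov (P' `&` E n x).
  move=> P'x covx; apply: (P'x n).
  apply: uniformly_coverableS (uniformly_coverableU WF covx covC) => y xy.
  by have [P'y|nP'y] := pselect (P' y); [left|right].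
have P'0 : P' !=set0.
  apply: contrapT => /nonemptyPn P'0; apply: ncT.
  by apply: uniformly_coverableS covC => x _; rewrite P'0; exact.
have [y yb yW] := Hlim W WF Wdec.
(* Two values within [4 * d] of [c0] differ by at most [8 * d = e], as [farW] needs. *)
pose d := e / 8; have d0 : 0 < d by rewrite /d; lra.
have [x0 P'x0 [n0 n0P]] := scale_baire1_oscillation cE yb P'cl P'0 d0.
pose c0 := y x0.
have nearW x : P' x -> E n0 x0 x -> W [set i | `|f i x - c0| < 2 * d].
  move=> P'x xx0; apply: filterS (yW x d d0) => i /= h.
  have h1 := n0P _ _ P'x P'x0 xx0 (scale_refl cE _ _).
  have := ler_distD (y x) (f i x) c0; rewrite /c0; lra.
have farW x n : P' x ->
    W [set i | exists q, [/\ P' q, E n x q & 4 * d < `|f i q - c0|]].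
  move=> P'x; set A := [set i | _]; have [//|WA] := Wdec A.
  (* Otherwise the complement of [A], repeated as a constant sequence, would cover a relative
     ball. *)
  exfalso; apply: (P'ball x n P'x); exists (fun=> ~` A); split=> // q [P'q xq].
  exists 0%N => i j nAi nAj.
  have le4 k : (~` A) k -> `|f k q - c0| <= 4 * d.
    by move=> nAk; rewrite leNgt; apply/negP => lt4; apply: nAk; exists q.
  have := ler_distD c0 (f i q) (f j q); have := le4 i nAi; have := le4 j nAj.
  rewrite (distrC c0) /d; lra.
pose inv m (p : (seq bool -> T) * nat) := forall t, size t = m ->
  P' (p.1 t) /\ forall z, E p.2 (p.1 t) z -> E n0 x0 z.
have step m (p : (seq bool -> T) * nat) :
    exists q : (seq bool -> T) * nat * I, inv m p ->
    [/\ inv m.+1 q.1, (p.2.+1 < q.1.2)%N &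
      forall t, size t = m -> forall b, E p.2.+1 (p.1 t) (q.1.1 (b :: t)) /\
      forall z, E q.1.2 (q.1.1 (b :: t)) z ->
        if b then 4 * d <= `|f q.2 z - c0| else `|f q.2 z - c0| <= 2 * d].
  have [i0 _] := filter_ex (filterT : W setT).
  have [pinv|npinv] := pselect (inv m p); last by exists (p, i0).
  (* One index serves all nodes of the level, because [W] is closed under finite intersections. *)
  have [i iP] : exists i, forall t, size t = m -> `|f i (p.1 t) - c0| < 2 * d /\
      exists q, [/\ P' q, E p.2.+1 (p.1 t) q & 4 * d < `|f i q - c0|].
    apply: (@filter_ex _ W); apply: filter_size => t tm.
    have [P't tz] := pinv t tm; apply: filterI; last exact: farW.
    by apply: nearW => //; apply: tz; exact: scale_refl.
  have qex t : exists q, size t = m ->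
      [/\ P' q, E p.2.+1 (p.1 t) q & 4 * d < `|f i q - c0|].
    have [tm|tm] := eqVneq (size t) m; last by exists x0 => /eqP; rewrite (negPf tm).
    by have [_ [q qP]] := iP t tm; exists q.
  have [q qP] := choice qex.
  have evc x P : (exists n, forall z, E n x z -> P z) ->
      \forall n \near \oo, forall z, E n x z -> P z.
    move=> [n nP]; exists n => // k /= nk z xz; apply: nP.
    exact: scale_leq xz.
  have [n [pn nP]] : exists n, (p.2.+1 < n)%N /\ forall t, size t = m ->
      (forall z, E n (p.1 t) z -> `|f i z - c0| <= 2 * d) /\
      (forall z, E n (q t) z -> 4 * d <= `|f i z - c0|).
    apply: (@filter_ex _ \oo); apply: filterI; first exact: nbhs_infty_gt.
    apply: filter_size => t tm; have [ft _] := iP t tm; have [_ _ fq] := qP t tm.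
    apply: filterI; apply: evc.
      have h : 0 < 2 * d - `|f i (p.1 t) - c0| by rewrite subr_gt0.
      have [n nP] := fc i (p.1 t) _ h; exists n => z /nP.
      have := ler_distD (f i (p.1 t)) (f i z) c0; rewrite (distrC (f i z) (f i _)); lra.
    have h : 0 < `|f i (q t) - c0| - 4 * d by rewrite subr_gt0.
    have [n nP] := fc i (q t) _ h; exists n => z /nP.
    have := ler_distD (f i z) (f i (q t)) c0; lra.
  (* Bit 0 stays at the node, where [f i] is near [c0]; bit 1 moves to a close point of [P'] where
     it is far. The value at the empty string is a dummy. *)
  pose c s := if s is b :: t then if b then q t else p.1 t else x0.
  have cE' t b' : size t = m -> P' (c (b' :: t)) /\ E p.2.+1 (p.1 t) (c (b' :: t)).
    move=> tm; case: b' => /=; first by have [] := qP t tm.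
    by split; [have [] := pinv t tm|exact: scale_refl].
  exists ((c, n), i) => _ /=; split=> // [[//|b' t] [tm]|t tm b'].
    have [P'c cb] := cE' t b' tm; split=> // z cz.
    have [_] := pinv t tm; apply; apply: (scale_trans cE cb).
    exact: scale_leq (ltnW pn) cz.
  split; first by have [] := cE' t b' tm.
  by have [? ?] := nP t tm; case: b'.
have [h hP] := choice (fun mp => step mp.1 mp.2).
pose st := fix st m := if m is m'.+1 then (h (m', st m')).1 else (fun=> x0, n0).
have invst m : inv m (st m).
  elim: m => [t _|m IH]; first by split.
  by have [] := hP (m, st m) IH.
have hst m := hP (m, st m) (invst m).
apply: (@no_cantor_scheme (fun t => (st (size t)).1 t) (fun m => (st m).2)
  (fun m => (h (m, st m)).2) c0 d) => //.
- by move=> b' t; have [_ _ /(_ t erefl b')[]] := hst (size t).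
- by move=> m; have [] := hst m.
- by move=> t z; have [_ _ /(_ t erefl true)[_]] := hst (size t); apply.
- by move=> t z; have [_ _ /(_ t erefl false)[_]] := hst (size t); apply.
Qed.
End Bisequential.

(** * From Polish spaces to continuous functions *)

Lemma complete_scale_prod (T : Type) (E : nat -> T -> T -> Prop) :
  complete_scale E ->
  complete_scale (fun n (z w : T * (nat -> nat)) =>
    E n z.1 w.1 /\ forall j, (j < n)%N -> z.2 j = w.2 j).
Proof.
move=> cE; split=> [n z|n z w [zw zw2]|n x y z [xy xy2] [yz yz2]|u uE].
- by split=> //; exact: scale_refl.
- by split=> [|j jn]; [exact: (scale_sym cE)|rewrite zw2].
- split=> [|j jn]; first exact: (scale_trans cE xy yz).
  by rewrite xy2 ?yz2// ltnW.
have [l ul] := scale_lim cE (fun m n mn => (uE m n mn).1).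
exists (l, fun j => (u j.+1).2 j) => n; split=> // j jn.
by rewrite /= (uE j.+1 n jn).2.
Qed.

Lemma complete_scale_sig (T : Type) (E : nat -> T -> T -> Prop) (F : set T) :
  complete_scale E -> scale_closed E F ->
  complete_scale (fun n (z w : {x | F x}) => E n (sval z) (sval w)).
Proof.
move=> cE Fcl; split=> [n z|n z w|n x y z|u uE].
- exact: scale_refl.
- exact: scale_sym.
- exact: scale_trans.
have [l ul] := scale_lim cE uE.
have Fl : F l.
  apply: Fcl => n; exists (sval (u n)); last exact: svalP.
  exact: (scale_sym cE).
by exists (exist _ l Fl).
Qed.

Lemma exp2Vn_lt (R : realType) (e : R) : 0 < e -> exists n, 2 ^- n < e.
Proof.
move=> /ltr_add_invr[N]; rewrite add0r => NP.
exists N; apply: le_lt_trans NP; rewrite lef_pV2 ?posrE ?ltr0n ?exprn_gt0//.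
by rewrite -natrX ler_nat ltn_expl.
Qed.

Lemma exp2VnS (R : realType) n : 2 ^- n.+1 + 2 ^- n.+1 = 2 ^- n :> R.
Proof. by rewrite exprS invfM; lra. Qed.

Section Polish.
Context {R : realType} {P : topologicalType} {d : P -> P -> R}.
Context (dP : complete_compatible_metric d).

Definition metric_scale n x y := d x y <= 2 ^- n.

Lemma complete_metric_scale : complete_scale metric_scale.
Proof.
have [d0 dC dtri dnbhs dcomp] := dP; rewrite /metric_scale.
split=> [n x|n x y|n x y z xy yz|u uE].
- by rewrite (d0 x x).2// invr_ge0 exprn_ge0.
- by rewrite dC.
- by rewrite (le_trans (dtri _ y _))// -exp2VnS lerD.
have [e e0|l ul] := dcomp u.
  have [N NP] := exp2Vn_lt e0; exists N.+1 => m n Nm Nn.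
  apply: le_lt_trans NP; rewrite -exp2VnS (le_trans (dtri _ (u N.+1) _))//.
  by rewrite lerD ?(dC (u m)) ?uE.
exists l => n; apply/ler_addgt0Pr => e e0.
have : nbhs l [set y | d l y < e] by apply/dnbhs; exists e.
move=> /ul [M _ MP]; have := MP (maxn M n) (leq_maxl _ _).
have := uE n _ (leq_maxr M n); have := dtri (u n) (u (maxn M n)) l.
rewrite /= (dC l); lra.
Qed.

Lemma metric_scale_nbhs x A : nbhs x A ->
  exists n, forall y, metric_scale n x y -> A y.
Proof.
have [_ _ _ dnbhs _] := dP => /dnbhs[e e0 eA].
have [n ne] := exp2Vn_lt e0; exists n => y xy; apply: eA.
exact: le_lt_trans ne.
Qed.

Lemma metric_scale_continuous (h : P -> R) :
  continuous h -> scale_continuous metric_scale h.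
Proof.
move=> hc x e e0; apply: metric_scale_nbhs.
by have /cvgrPdist_lt/(_ e e0) := hc x.
Qed.

Lemma metric_scale_base : separable_space P ->
  exists (J : countType) (b : J -> set P), forall x n,
    exists2 k, b k x & forall y, b k y -> metric_scale n x y.
Proof.
have [_ dC dtri dnbhs _] := dP; move=> [D /countable_injP[f finj] Dd].
exists (nat * nat)%type, (fun k => [set x | exists q,
  [/\ D q, f q = k.1 & metric_scale k.2 x q]]) => x n.
pose A := [set y | d x y < 2 ^- n.+1].
have xA : nbhs x A by apply/dnbhs; exists (2 ^- n.+1) => //; rewrite invr_gt0 exprn_gt0.
have [||q [/interior_subset Aq Dq]] := Dd A^°.
- by exists x.
- exact: open_interior.
exists (f q, n.+1) => [|y [q' [Dq' /= /finj fq yq]]].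
  by exists q; split=> //; exact: ltW.
move: yq; rewrite (fq _ _) ?inE// /metric_scale => yq.
rewrite (le_trans (dtri _ q _))// -exp2VnS lerD// ?(dC q)//; exact: ltW.
Qed.

End Polish.

(* Pairing a point with moduli of convergence of the approximations [g i] makes
   each limit [F i] continuous. *)
Section Modulus.
Context {R : realType} {T : Type} {E : nat -> T -> T -> Prop}.
Context (cE : complete_scale E) {I : countType}.
Context (g : I -> nat -> T -> R) (F : I -> T -> R).
Context (gc : forall i n, scale_continuous E (g i n)).
Context (gF : forall i x, (fun n => g i n x) @ \oo --> F i x).

Definition modulus (z : T * (nat -> nat)) := forall i k n m,
  (z.2 (choice.pickle (i, k)) <= n)%N -> (z.2 (choice.pickle (i, k)) <= m)%N ->
  `|g i n z.1 - g i m z.1| <= k.+1%:R^-1.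

Definition modulus_space := {z | modulus z}.

Definition modulus_scale n (z w : modulus_space) :=
  E n (sval z).1 (sval w).1 /\ forall j, (j < n)%N -> (sval z).2 j = (sval w).2 j.

(** The bounds are non-strict, continuous in the point and dependent on one coordinate of the
    modulus each, so they cut out a closed subset of the product. *)
Lemma complete_modulus_scale : complete_scale modulus_scale.
Proof.
apply: (complete_scale_sig (complete_scale_prod cE)) => z zm i k n m zn zk.
apply/ler_addgt0Pr => e e0; have e2 : 0 < e / 2 by lra.
have [n1 n1P] := gc i n z.1 e2; have [m1 m1P] := gc i m z.1 e2.
have [w [zw zw2] wm] := zm (maxn (maxn n1 m1) (choice.pickle (i, k)).+1).
have jw := zw2 (choice.pickle (i, k)) (leq_maxr _ _).
have h1 := n1P _ (scale_leq cE (leq_trans (leq_maxl _ _) (leq_maxl _ _)) zw).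
have h2 := m1P _ (scale_leq cE (leq_trans (leq_maxr _ _) (leq_maxl _ _)) zw).
have h3 : `|g i n w.1 - g i m w.1| <= k.+1%:R^-1 by apply: wm; rewrite -jw.
have h4 := ler_distD (g i n w.1) (g i n z.1) (g i m z.1).
have h5 := ler_distD (g i m w.1) (g i n w.1) (g i m z.1).
rewrite (distrC (g i m w.1)) in h5; move: (_^-1) h3 => a h3; lra.
Qed.

Lemma modulus_scale_base :
  (exists (J : countType) (b : J -> set T), forall x n,
    exists2 k, b k x & forall y, b k y -> E n x y) ->
  exists (J : countType) (b : J -> set modulus_space), forall x n,
    exists2 k, b k x & forall y, b k y -> modulus_scale n x y.
Proof.
move=> [J [b bE]].
exists (J * seq nat)%type, (fun k => [set z | b k.1 (sval z).1 /\
  forall j, (j < size k.2)%N -> (sval z).2 j = nth 0%N k.2 j]) => x n.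
have [k kx kE] := bE (sval x).1 n.
exists (k, mkseq (sval x).2 n) => [|y [/= ky yx]].
  by split=> //= j; rewrite size_mkseq => jn; rewrite nth_mkseq.
split; first exact: kE.
by move=> j jn; rewrite yx ?size_mkseq// nth_mkseq.
Qed.

Lemma modulus_surj (x : T) : exists z : modulus_space, (sval z).1 = x.
Proof.
have Nex j : exists N : nat, forall i k, j = choice.pickle (i, k) ->
    forall n m, (N <= n)%N -> (N <= m)%N -> `|g i n x - g i m x| <= k.+1%:R^-1.
  case jE : (@choice.unpickle (I * nat)%type j) => [[i k]|]; last first.
    by exists 0%N => i k ji; rewrite ji choice.pickleK in jE.
  have k2 : (0 : R) < k.+1%:R^-1 / 2 by rewrite divr_gt0// invr_gt0.
  have /cvgrPdist_lt/(_ _ k2)[N _ NP] := @gF i x.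
  exists N => i' k' ji n m Nn Nm; move: jE; rewrite ji choice.pickleK => -[-> ->].
  have := ler_distD (F i x) (g i n x) (g i m x).
  move: (NP _ Nn) (NP _ Nm) => /=; rewrite (distrC (F i x) (g i n x)).
  by move: (k.+1%:R^-1) => a; lra.
have [N NP] := choice Nex.
have zm : modulus (x, N) by move=> i k n m; apply: NP.
by exists (exist _ _ zm).
Qed.

(** Near [z] the modulus coordinate of [(i, k)] is constant, so there the single continuous [g i N]
    approximates [F i] uniformly up to [1 / (k + 1)]. *)
Lemma modulus_limit_continuous i :
  scale_continuous modulus_scale (fun z => F i (sval z).1).
Proof.
move=> z e e0; have e4 : 0 < e / 4 by lra.
have [k] := ltr_add_invr e4; rewrite add0r => ke.
pose j := choice.pickle (i, k); pose N := (sval z).2 j.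
have [n nP] := gc i N (sval z).1 e4.
have near (w : modulus_space) : (sval w).2 j = N ->
    `|F i (sval w).1 - g i N (sval w).1| < e / 4 + e / 100.
  move=> wN; have e9 : 0 < e / 100 by lra.
  have /cvgrPdist_lt/(_ _ e9)[M _ MP] := @gF i (sval w).1.
  have h1 := MP _ (leq_maxl M N).
  have h2 : `|g i (maxn M N) (sval w).1 - g i N (sval w).1| <= k.+1%:R^-1.
    by apply: (svalP w); rewrite wN// leq_maxr.
  have := ler_distD (g i (maxn M N) (sval w).1) (F i (sval w).1) (g i N (sval w).1).
  by move: (k.+1%:R^-1) ke h2 h1 => a /=; lra.
exists (maxn n j.+1) => w [zw zw2].
have h1 := nP _ (scale_leq cE (leq_maxl _ _) zw).
have h2 := near z erefl.
have h3 := near w (esym (zw2 j (leq_maxr _ _))).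
have h4 := ler_distD (g i N (sval z).1) (F i (sval z).1) (F i (sval w).1).
have h5 := ler_distD (g i N (sval w).1) (g i N (sval z).1) (F i (sval w).1).
rewrite distrC in h3; lra.
Qed.

Lemma modulus_baire1 (y : T -> R) :
  scale_baire1 E y -> scale_baire1 modulus_scale (fun z => y (sval z).1).
Proof.
move=> [h hc hy]; exists (fun n z => h n (sval z).1) => [n z e e0|z].
  by have [k kP] := hc n (sval z).1 e e0; exists k => w [/kP].
exact: hy.
Qed.

End Modulus.

(** * Ultrafilter limits and bisequentiality in Rosenthal compacta *)

Lemma baire_class1_scale (R : realType) (P : topologicalType) (d : P -> P -> R)
    (y : P -> R) :
  complete_compatible_metric d -> baire_class1 y ->
  scale_baire1 (metric_scale (d := d)) y.
Proof.
move=> dP [g [gc gy]]; exists g => [n|x e e0].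
  exact: metric_scale_continuous.
have /cvgrPdist_lt/(_ e e0)[N _ NP] := gy x; exists N => n Nn.
by rewrite distrC; exact: NP.
Qed.

(** Compactness gives a cluster point, and decisiveness turns clustering into convergence: if a
    neighbourhood condition failed to be in [G], its negation would be in [G] and would have to meet
    that neighbourhood. *)
Lemma compact_decisive_limit (R : realType) (P : topologicalType)
    (K : set {ptws P -> R}) (I : Type) (f : I -> P -> R)
    (G : set_system I) :
  compact K -> (forall i, K (f i)) -> ProperFilter G -> decisive G ->
  exists2 y, K y & forall p e, 0 < e -> G [set i | `|f i p - y p| < e].
Proof.
move=> Kc Kf GF Gdec.
have [|y [Ky yG]] := Kc (f @ G : set_system {ptws P -> R}) _.
  by apply: (@filterE _ G) => i; exact: Kf.
exists y => // p e e0.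
set A := [set i | _]; have [//|GA] := Gdec A.
have ev : {for y, continuous (fun h : {ptws P -> R} => h p)}.
  exact: proj_continuous.
have /cvgrPdist_lt/(_ e e0) yB := ev.
have nG : (f @ G) [set h | ~ (`|h p - y p| < e)] by exact: GA.
by have [h [/= hy yh]] := yG _ _ nG yB; exfalso; apply: hy; rewrite distrC.
Qed.

(* Bisequentiality of [K] at the limit along [W], with the convergence of the
   sets [A n] replaced by its Cauchy form. *)
Lemma rosenthal_bisequential (R : realType) (P : topologicalType)
    (K : set {ptws P -> R}) (I : countType) (f : I -> P -> R)
    (W : set_system I) :
  rosenthal_compactum K -> (forall i, K (f i)) ->
  ProperFilter W -> decisive W ->
  exists2 A : nat -> set I, forall n, W (A n) &
    forall p e, 0 < e -> exists n, forall i j, A n i -> A n j ->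
      `|f i p - f j p| <= e.
Proof.
move=> [[Psep [d dP]] KB Kc] Kf WF Wdec.
have [g gP] := choice (fun i => KB _ (Kf i)).
have gc i n : scale_continuous (metric_scale (d := d)) (g i n).
  by apply: metric_scale_continuous => //; have [] := gP i.
have gF i x : (fun n => g i n x) @ \oo --> f i x by have [] := gP i.
have cM := complete_modulus_scale (complete_metric_scale dP) gc.
have [J [b bE]] := modulus_scale_base g (metric_scale_base dP Psep).
have Hlim : baire1_limits
    (E := modulus_scale (E := metric_scale (d := d)) (g := g))
    (fun i z => f i (sval z).1).
  move=> G GF Gdec; have [y Ky yG] := compact_decisive_limit Kc Kf GF Gdec.
  exists (fun z => y (sval z).1) => [|z]; last exact: yG.
  by apply: modulus_baire1; apply: baire_class1_scale => //; exact: KB.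
have Aex k : exists A : nat -> set I, (forall n, W (A n)) /\ forall p,
    exists n, forall i j, A n i -> A n j -> `|f i p - f j p| <= k.+1%:R^-1.
  have k0 : (0 : R) < k.+1%:R^-1 by rewrite invr_gt0.
  have [|A [WA AP]] := uniformly_coverableT cM bE _ Hlim WF Wdec k0.
    by move=> i; exact: (modulus_limit_continuous (complete_metric_scale dP) gc gF).
  exists A; split=> // p; have [z <-] := modulus_surj gF p.
  exact: AP.
have [A AP] := choice Aex.
exists (fun n => if @choice.unpickle (nat * nat)%type n is Some (k, m)
  then A k m else setT) => [n|p e e0].
  by case: choice.unpickle => [[k m]|]; [have [] := AP k|exact: filterT].
have [k] := ltr_add_invr e0; rewrite add0r => ke.
have [_ /(_ p)[m mP]] := AP k.
exists (choice.pickle (k, m)) => i j; rewrite choice.pickleK => Ai Aj.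
exact: le_trans (mP _ _ Ai Aj) (ltW ke).
Qed.

(* [K : Type] is the subtype of the elements of [K], with the subspace topology
   of the pointwise convergence topology. *)
Theorem corollary4p5 (R : realType) (P : topologicalType)
    (K : set {ptws P -> R}) :
  rosenthal_compactum K -> omega1_sequentially_compact K.
Proof.
move=> KR _ B Bbar _ f.
have [U [UU Uoo]] := ultraFilterLemma eventually_filter.
pose W : set_system {fset nat} := [set A | tree_large U B A fset0].
have Wdec : decisive W.
  by move=> A; apply: tree_large_decisive => //; exact: ultra_decisive.
have WF : ProperFilter W.
  split; first exact: tree_large_set0.
  split=> [|A A' WA WA'|A A' AA']; last exact: tree_largeS.
    by have [//|] := Wdec setT; rewrite setCT => /tree_large_set0.
  exact: tree_largeI.
pose h s : P -> R := set_val (f s).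
have Kh s : K (h s) by exact: set_valP.
have [A WA AP] := rosenthal_bisequential KR Kh WF Wdec.
have [_ _ Kc] := KR.
have [x Kx xW] := compact_decisive_limit Kc Kh WF Wdec.
have [e eS eA] := tree_large_diagonal Uoo Bbar WA.
exists (range e); split; first exact/infinite_range/increasing_inj.
exists (SigSub (mem_set Kx)).
pose BM := family_restr B (range e).
(* The filter of tails of [BM], which turns barrier convergence into filter convergence. *)
pose G : set_system {fset nat} := [set S | exists n,
  family_restr BM (range e `\` `I_n) `<=` S].
have GF : Filter G.
  split=> [|S S' [n nS] [m mS]|S S' SS' [n nS]]; first by exists 0%N.
    exists (maxn n m) => s [Bs se].
    split; [apply: nS|apply: mS]; split=> // i /se[ei ni]; split=> // im;
      apply: ni => /=; apply: leq_trans im _.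
    - exact: leq_maxl.
    - exact: leq_maxr.
  by exists n; exact: subset_trans SS'.
have hx : h @ G --> (x : {ptws P -> R}).
  apply/pointwise_cvgP => p; apply/cvgrPdist_le => d d0.
  have [n nP] := AP p d d0.
  (* From [e n] on, the elements of [range e] are the [e j] with [n <= j]. *)
  exists (e n) => s [[Bs _] se].
  have As : A n s.
    apply: eA => // i /se[[j _ <-] /negP]; rewrite -leqNgt => ej; exists j => //=.
    by rewrite leqNgt; apply/negP => /eS; rewrite ltnNge ej.
  (* Some [t] in [A n] has [h t p] within [c] of [x p], while [h s p] and [h t p] differ by at most
     [d]. *)
  apply/ler_addgt0Pr => c c0.
  have [t [At /= xt]] := filter_ex (filterI (WA n) (xW p c c0)).
  have := nP _ _ As At; have := ler_distD (h t p) (h s p) (x p).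
  rewrite (distrC (x p)); lra.
move=> _ [O Oo <-] Ox.
have [n nO] : G (h @^-1` O) by apply: hx; exact: open_nbhs_nbhs.
by exists n => _ [s sn <-]; exact: nO.
Qed.
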